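(* For a real $x>2$, let $\mathcal A_x$ be the following randomized preemptive online algorithm for $\textsc{Part}$ with $p=2$ on sequences $X=w_1,\dots,w_n$ of positive integers: choose $\delta\in(0,1)$ uniformly at random; view $X$ as a sequence of $W_n=\sum_{i=1}^n w_i$ unit requests, and simulate on it the rule ''move the separator to the current unit position $j$ whenever $j=\lceil x^{i+\delta}\rceil$, then increment $i$ (starting from $i=0$)''; whenever this rule would place the separator at a unit position lying inside the block of units corresponding to $w_i$, the separator is placed right after $w_i$. Let $R^X_{\mathcal A_x}$ be the ratio of the resulting bottleneck value to the optimal bottleneck value. Then there is a constant $x\approx 5.357$ such that $\mathbb E[R^X_{\mathcal A_x}]\le 1.627 + O(W_n^{-1})$ for every sequence $X$ of positive integers of total weight $W_n$.
   Context: $\textsc{Part}$ with $p=2$: one separator must be placed in a sequence of positive integers to split it into two contiguous blocks minimizing the larger block weight (the bottleneck value). Preemptive online model: requests arrive one by one; when processing the current request the algorithm may remove its previously placed separator and can place a separator only right after the current request. The expectation is over $\delta$. *)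

(* Defs.v *)
From HB Require Import structures.
From mathcomp Require Import all_boot all_order all_algebra.
From mathcomp Require Import all_classical all_reals all_analysis.
From mathcomp Require Import measurable_realfun.

Set Implicit Arguments.
Unset Strict Implicit.
Unset Printing Implicit Defensive.

Import Order.TTheory GRing.Theory Num.Theory.

Local Open Scope nat_scope.

(* A separator in X is encoded by the number k <= size X of requests on its
   left. The value k = 0 (empty left block) also stands for "no separator placed
   yet": the whole of X is then a single block. *)
Definition bottleneck (X : seq nat) (k : nat) : nat :=
  maxn (sumn (take k X)) (sumn (drop k X)).

(* The default value sumn X is bottleneck X 0, itself one of the candidates. *)
Definition opt_bottleneck (X : seq nat) : nat :=
  \big[minn/sumn X]_(k < (size X).+1) bottleneck X k.

(* Separator position in X corresponding to the unit position j, where the units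
   of X are numbered from 1: the least k such that the first k requests contain
   the unit j, i.e. "right after w_k" when j is one of the units of w_k. *)
Definition sep_of_unit (X : seq nat) (j : nat) : nat :=
  find (fun k => j <= sumn (take k X)) (iota 0 (size X).+1).

Section Algorithm.
Context {R : realType}.
Implicit Types (x delta : R) (X : seq nat).

(* The state (i, s) holds the counter i and the unit position s right after which
   the separator currently stands (s = 0 if none has been placed). *)
Definition unit_step x delta (st : nat * nat) (j : nat) : nat * nat :=
  if (j%:Z == Num.ceil (x `^ (st.1%:R + delta)))%R then (st.1.+1, j) else st.

Definition unit_sep x delta (W : nat) : nat :=
  (foldl (unit_step x delta) (0, 0) (iota 1 W)).2.

Definition alg_sep x X delta : nat := sep_of_unit X (unit_sep x delta (sumn X)).

Definition alg_ratio x X delta : R :=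
  ((bottleneck X (alg_sep x X delta))%:R / (opt_bottleneck X)%:R)%R.

Lemma measurable_alg_ratio x X : measurable_fun setT (alg_ratio x X).
Proof.
rewrite /alg_ratio /alg_sep /unit_sep.
pose h (s : nat) : R :=
  ((bottleneck X (sep_of_unit X s))%:R / (opt_bottleneck X)%:R)%R.
elim: (iota _ _) (0, 0) => [|j l IHl] st /=; first exact: measurable_cst.
set b := fun delta => (j%:Z == Num.ceil (x `^ (st.1%:R + delta)))%R.
rewrite (_ : (fun delta => _) = fun delta => if b delta
  then h (foldl (unit_step x delta) (st.1.+1, j) l).2
  else h (foldl (unit_step x delta) st l).2); last first.
  by apply/funext => delta; rewrite {2}/unit_step -/(b delta); case: ifP.
have mpow : measurable_fun setT (fun delta => x `^ (st.1%:R + delta))%R.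
  by apply: measurableT_comp; [exact: measurable_powRr|exact: measurable_funD].
apply: measurable_fun_ifT; [|exact: IHl|exact: IHl].
rewrite (_ : b = fun delta => ((j%:R - 1 < x `^ (st.1%:R + delta)) &&
    (x `^ (st.1%:R + delta) <= j%:R))%R).
  by apply: measurable_and; [exact: measurable_fun_ltr|exact: measurable_fun_ler].
by apply/funext => delta; rewrite /b eq_sym ceil_eq rmorphB.
Qed.

HB.instance Definition _ x X :=
  isMeasurableFun.Build _ _ _ _ (alg_ratio x X) (measurable_alg_ratio x X).

End Algorithm.

(* Main.v *)
Require Import Defs.
From mathcomp Require Import all_boot all_order all_algebra.
From mathcomp Require Import all_classical all_reals all_analysis.
From mathcomp Require Import measurable_realfun ring lra zify.

Import Order.TTheory GRing.Theory Num.Theory.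
Import numFieldNormedType.Exports.

Local Open Scope ring_scope.

(* Write W for the total weight, O for the optimal bottleneck value. When W >= x,
   the point z = x^(k+delta) that triggered the last move is log-uniform on
   (W/x, W]. The bottleneck value is at most W, and at most W - z as soon as
   z <= W - O. Since E[z; z <= W - O] >= (W - O - W/x) / ln x, the expected ratio is
   at most (W - (W - O - W/x) / ln x) / O, which, as W <= 2 O, is at most
   2 - (1 - 2/x) / ln x. This is minimal when 2 ln x = x - 2, i.e. x = 5.357 up to
   rounding, and is below 1.627 there. When W < x the ratio is at most 2. *)

(** * Cuts of a sequence and their bottleneck values *)

Lemma opt_bottleneck_attained (X : seq nat) :
  exists k, opt_bottleneck X = bottleneck X k.
Proof.
rewrite /opt_bottleneck.
elim/big_ind: _ => [|m n [i ->] [j ->]|i _]; last by exists i.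
- by exists 0%N; rewrite /bottleneck take0 drop0 max0n.
- by rewrite /minn; case: ifP => _; [exists i|exists j].
Qed.

Lemma sumn_take_drop (X : seq nat) k :
  (sumn (take k X) + sumn (drop k X))%N = sumn X.
Proof. by rewrite -sumn_cat cat_take_drop. Qed.

Lemma sumn_take_le (X : seq nat) i j :
  (i <= j)%N -> (sumn (take i X) <= sumn (take j X))%N.
Proof.
by move=> ij; rewrite -(minn_idPl ij) take_min -[leqRHS](sumn_take_drop _ i) leq_addr.
Qed.

Lemma bottleneck_le (X : seq nat) k : (bottleneck X k <= sumn X)%N.
Proof. by rewrite /bottleneck; have := sumn_take_drop X k; lia. Qed.

Lemma sumn_take_sep_of_unit (X : seq nat) j : (j <= sumn X)%N ->
  (j <= sumn (take (sep_of_unit X j) X))%N.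
Proof.
move=> jX; rewrite /sep_of_unit; set P := fun k => _.
have hP : has P (iota 0 (size X).+1).
  by apply/hasP; exists (size X); rewrite ?mem_iota//= /P take_size.
have := nth_find 0%N hP; move: hP; rewrite has_find size_iota => hP.
by rewrite nth_iota.
Qed.

Lemma sep_of_unit_min (X : seq nat) j k : (j <= sumn (take k X))%N ->
  (sep_of_unit X j <= k)%N.
Proof.
move=> jk; rewrite leqNgt; apply/negP => ltk.
have := before_find 0%N ltk; rewrite nth_iota ?jk//.
by rewrite (leq_trans ltk)// (leq_trans (find_size _ _))// size_iota.
Qed.

(** The larger of two complementary blocks carries at least half of the total weight. *)
Lemma opt_bottleneck_ge (X : seq nat) : (sumn X <= 2 * opt_bottleneck X)%N.
Proof.
have [k ->] := opt_bottleneck_attained X.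
by rewrite /bottleneck; have := sumn_take_drop X k; lia.
Qed.

Lemma opt_bottleneck_le (X : seq nat) : (opt_bottleneck X <= sumn X)%N.
Proof. by have [k ->] := opt_bottleneck_attained X; exact: bottleneck_le. Qed.

(* The right block of an optimal cut weighs at most [opt_bottleneck X], so that cut
   is not left of [j], and the cut made for [j] is not right of it. *)
Lemma bottleneck_sep_of_unit (X : seq nat) j :
  (j + opt_bottleneck X <= sumn X)%N ->
  (bottleneck X (sep_of_unit X j) + j <= sumn X)%N.
Proof.
have [k ->] := opt_bottleneck_attained X => jX.
have jk : (j <= sumn (take k X))%N.
  by move: jX; rewrite /bottleneck; have := sumn_take_drop X k; lia.
have jX' : (j <= sumn X)%N by lia.
have jsep := sumn_take_sep_of_unit X j jX'.
have := sumn_take_le X _ _ (sep_of_unit_min X j k jk).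
have := sumn_take_drop X (sep_of_unit X j); have := sumn_take_drop X k.
by move: jX; rewrite /bottleneck; lia.
Qed.

(** * Trajectory of the separator on the unit sequence *)

Section GeometricSeparator.
Variables (R : realType) (x delta : R).
Hypotheses (x_gt2 : 2 < x) (delta_ge0 : 0 <= delta).

(** The rule tests [j] only for equality with the current ceiling, so it would stall if two
    consecutive points had the same ceiling. This cannot happen: a point z is at least 1 and x > 2,
    hence x z > 2 z >= z + 1. *)
Lemma unit_sep_inv (n : nat) :
  let: (i, s) := foldl (unit_step x delta) (0%N, 0%N) (iota 1 n) in
  n%:R < x `^ (i%:R + delta) /\
  (if i is k.+1 then
     x `^ (k%:R + delta) <= n%:R /\ s%:Z = Num.ceil (x `^ (k%:R + delta))
   else True).
Proof.
have x_gt0 : 0 < x by apply: lt_trans x_gt2.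
elim: n => [|n IHn]; first by split => //=; exact: powR_gt0.
rewrite -[n.+1]addn1 iotaD foldl_cat add1n /=.
case: (foldl _ _ _) IHn => i s [ltn IHi]; rewrite /unit_step /= addn1.
set z := x `^ (i%:R + delta) in ltn *.
have z_ge1 : 1 <= z.
  rewrite -(powRr0 x) ler_powR ?addr_ge0 ?ler0n// ltW//.
  by apply: lt_trans x_gt2; rewrite ltr1n.
have xz : x `^ (i.+1%:R + delta) = x * z.
  rewrite -natr1 -addrA (addrC 1) addrA powRD ?powRr1 1?mulrC ?ltW//.
  by rewrite (gt_eqF x_gt0) implybT.
case: eqP => [nz|/eqP nz].
  have : z <= n.+1%:R by have := ceil_ge z; rewrite -nz.
  split => //; rewrite xz.
  have : 2 * z < x * z by rewrite ltr_pM2r//; lra.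
  by rewrite -natr1; lra.
split; last first.
  case: i IHi {nz ltn z z_ge1 xz} => // k [zn ->]; split => //.
  by rewrite (le_trans zn)// ler_nat.
(* If z <= n + 1, then n < z makes n + 1 the ceiling of z, and the rule would have fired. *)
rewrite ltNge; apply/negP => zn; move: nz; rewrite eq_sym ceil_eq zn andbT.
by rewrite rmorphB /= -pmulrn -natr1 addrK ltn.
Qed.

Lemma unit_sepE (W : nat) : x `^ delta <= W%:R -> exists k : nat,
  x `^ (k%:R + delta) <= W%:R < x `^ (k.+1%:R + delta) /\
  (unit_sep x delta W)%:Z = Num.ceil (x `^ (k%:R + delta)).
Proof.
move=> xW; rewrite /unit_sep; have := unit_sep_inv W.
case: (foldl _ _ _) => -[|k] s [Wx]; first by move: Wx; rewrite add0r ltNge xW.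
by case=> xkW ->; exists k; rewrite xkW.
Qed.

(** Rounding up costs nothing: the difference of total and optimum is an integer, so a bound of z by
    it passes to the ceiling of z, and the saving at the ceiling is at least z. *)
Lemma bottleneck_alg_sep (X : seq nat) : x `^ delta <= (sumn X)%:R ->
  exists k : nat, x `^ (k%:R + delta) <= (sumn X)%:R < x `^ (k.+1%:R + delta) /\
  (x `^ (k%:R + delta) <= (sumn X)%:R - (opt_bottleneck X)%:R ->
   (bottleneck X (alg_sep x X delta))%:R + x `^ (k%:R + delta) <= (sumn X)%:R).
Proof.
move=> /unit_sepE[k [kW sepE]]; exists k; split=> // zle.
rewrite /alg_sep; move: (unit_sep _ _ _) sepE => j jE.
have zj : x `^ (k%:R + delta) <= j%:R.
  by have := ceil_ge (x `^ (k%:R + delta)); rewrite -jE.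
have jW : (j + opt_bottleneck X <= sumn X)%N.
  have OW := opt_bottleneck_le X.
  suff : (j%:Z <= (sumn X - opt_bottleneck X)%N%:Z)%R by rewrite lez_nat; lia.
  by rewrite jE ceil_le_int -pmulrn natrB.
have := bottleneck_sep_of_unit X j jW.
rewrite -(ler_nat R) natrD; lra.
Qed.

End GeometricSeparator.

(** * A numerical bound on the logarithm *)

Lemma exp_partial_sum_le (R : realType) (y : R) n : 0 <= y ->
  \sum_(0 <= i < n) y ^+ i / i`!%:R <= expR y.
Proof.
move=> y0; apply: (@nondecreasing_cvgn_le _ (series (exp_coeff y))).
  by apply: nondecreasing_series => i _ _; exact: exp_coeff_ge0.
exact: is_cvg_series_exp_coeff.
Qed.

Lemma ln_5357_le (R : realType) : ln (5357 / 1000 : R) <= 168 / 100.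
Proof.
rewrite -[leRHS]expRK ler_ln ?posrE ?expR_gt0 ?divr_gt0 ?ltr0n//.
rewrite (_ : 168 / 100 = 4%:R * (42 / 100) :> R); last by field.
(* Dividing the exponent by 4 lets five Taylor terms suffice; 35/23 is a simple fraction below their
   sum whose fourth power still exceeds 5.357. *)
have exp42 : 35 / 23 <= expR (42 / 100 : R).
  apply: le_trans (@exp_partial_sum_le R _ 5 _); last by lra.
  by rewrite !big_nat_recr//= big_geq// !factS fact0; lra.
have q0 : 0 <= 35 / 23 :> R by lra.
rewrite expRM_natl; have := lerXn2r 4 _ _ exp42.
by rewrite !nnegrE expR_ge0 q0 => /(_ isT isT); apply: le_trans; lra.
Qed.

(** * Integrals over the random shift *)

Lemma integral_powR_itv (R : realType) (x c p q : R) : 1 < x -> p <= q ->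
  (\int[lebesgue_measure]_(d in `]p, q]) (x `^ (c + d))%:E =
   ((x `^ (c + q) - x `^ (c + p)) / ln x)%:E)%E.
Proof.
move=> x1; rewrite le_eqVlt => /predU1P[<-|pq].
  by rewrite set_itv_ge ?bnd_simp ?ltxx// integral_set0 subrr mul0r.
have x0 : 0 < x by apply: lt_trans x1.
have lnx : ln x != 0 by rewrite gt_eqF// ln_gt0.
pose F d := x `^ (c + d) / ln x.
have dF d : is_derive d (1 : R) F (x `^ (c + d)).
  rewrite /F /powR gt_eqF//.
  apply: is_derive_eq; rewrite /GRing.scale /=; field.
  exact: lnx.
have cf : continuous (fun d => x `^ (c + d)).
  move=> d; rewrite /powR gt_eqF//.
  apply: continuous_comp; last exact: continuous_expR.
  by apply: cvgM; [apply: cvgD; [exact: cvg_cst|exact: cvg_id]|exact: cvg_cst].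
have cF : continuous F by move=> d; apply: cvgM; [exact: cf|exact: cvg_cst].
rewrite integral_itv_obnd_cbnd; last first.
  apply/measurable_EFinP/measurable_funTS; exact: continuous_measurable_fun.
rewrite (@continuous_FTC2 _ _ F)//.
- by rewrite -EFinB /F mulrBl.
- exact: continuous_subspaceT.
- split => [d _||]; first exact: ex_derive.
    exact/cvg_at_right_filter/cF.
  exact/cvg_at_left_filter/cF.
- by move=> d _; rewrite derive1E; exact: derive_val.
Qed.

Lemma alg_ratio_ge0 (R : realType) (x delta : R) (X : seq nat) :
  0 <= alg_ratio x X delta.
Proof. exact: divr_ge0. Qed.

Lemma expectation_alg_ratioE (R : realType) (x : R) (X : seq nat) :
  ('E_(uniform_prob (@ltr01 R))[alg_ratio x X] =
   \int[lebesgue_measure]_(d in `[0%R, 1%R]) (alg_ratio x X d)%:E)%E.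
Proof.
rewrite unlock integral_uniform//=.
- by rewrite subr0 invr1 mul1e.
- by apply/measurable_EFinP; exact: measurable_alg_ratio.
- by move=> d; rewrite lee_fin alg_ratio_ge0.
Qed.

Lemma expectation_alg_ratio_le (R : realType) (x b : R) (X : seq nat) :
  (forall d, d \in `[0, 1] -> alg_ratio x X d <= b) ->
  ('E_(uniform_prob (@ltr01 R))[alg_ratio x X] <= b%:E)%E.
Proof.
move=> rb; rewrite expectation_alg_ratioE.
have -> : b%:E = (\int[lebesgue_measure]_(d in `[0%R, 1%R]) (cst b%:E) (d : R))%E.
  by rewrite integral_cst//= lebesgue_measure_itv/= lte_fin ltr01 sube0 mule1.
apply: ge0_le_integral => //=.
- by move=> d _; rewrite lee_fin alg_ratio_ge0.
- by apply/measurable_EFinP/measurable_funTS; exact: measurable_alg_ratio.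
Qed.

(** As p <= t, the two intervals are disjoint, so at each [d] at most one of the powers, cut off to
    its interval, is added to [f d], and the sum stays below W. Adding the savings rather than
    subtracting them keeps all integrands nonnegative. *)
Lemma integral_add_powR_le (R : realType) (f : R -> R) (x W c1 c2 p t q : R) :
  1 < x -> 0 <= p -> p <= t -> t <= q -> q <= 1 ->
  measurable_fun setT f -> (forall d : R, 0 <= f d) ->
  (forall d : R, 0 <= d <= 1 -> f d <= W) ->
  (forall d : R, 0 < d <= p -> f d + x `^ (c1 + d) <= W) ->
  (forall d : R, t < d <= q -> f d + x `^ (c2 + d) <= W) ->
  (\int[lebesgue_measure]_(d in `[0%R, 1%R]) (f d)%:E +
    ((x `^ (c1 + p) - x `^ (c1 + 0)) / ln x +
     (x `^ (c2 + q) - x `^ (c2 + t)) / ln x)%:E <= W%:E)%E.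
Proof.
move=> x1 p0 pt tq q1 mf f0 fW fp fq.
pose g (c d : R) := (x `^ (c + d))%:E.
have mg (c : R) : measurable_fun [set: R] (g c).
  apply/measurable_EFinP; apply: measurableT_comp; first exact: measurable_powRr.
  exact: measurable_funD.
have mgA (c : R) (A : set R) : measurable A ->
    measurable_fun (`[0, 1]%classic : set R) (g c \_ A).
  move=> mA; apply: measurable_funTS; apply/(measurable_restrictT _ mA).
  by apply: measurable_funTS; apply: mg.
have gA0 (c : R) (A : set R) (d : R) : (0 <= (g c \_ A) d)%E.
  by rewrite patchE; case: ifP => _ //; rewrite lee_fin powR_ge0.
have ig (c u v : R) : 0 <= u -> u <= v -> v <= 1 ->
    (\int[lebesgue_measure]_(d in `[0%R, 1%R]) (g c \_ `]u, v]) d =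
     ((x `^ (c + v) - x `^ (c + u)) / ln x)%:E)%E.
  move=> u0 uv v1; rewrite -integral_mkcondr setIidr ?integral_powR_itv//.
  move=> d /=; rewrite !in_itv/= => /andP[ud dv].
  by rewrite (le_trans u0 (ltW ud)) (le_trans dv).
have mEf : measurable_fun (`[0, 1]%classic : set R) (EFin \o f).
  exact/measurable_EFinP/measurable_funTS.
have p1 : p <= 1 by lra.
have t0 : 0 <= t by lra.
rewrite EFinD -!ig//.
rewrite -ge0_integralD//=; last by apply: mgA.
  rewrite -ge0_integralD//=.
  - have -> : W%:E = (\int[lebesgue_measure]_(d in `[0%R, 1%R]) (cst W%:E) (d : R))%E.
      by rewrite integral_cst//= lebesgue_measure_itv/= lte_fin ltr01 sube0 mule1.
    apply: ge0_le_integral => //=.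
    + by move=> d _; rewrite !adde_ge0// lee_fin.
    + by do 2?[apply: emeasurable_funD] => //; exact: mgA.
    + move=> d; rewrite in_itv/= => d01.
      rewrite !patchE /g; case: ifPn; rewrite ?inE ?notin_setE /= in_itv /=.
        move=> dp; rewrite ifF ?adde0 -?EFinD ?lee_fin ?fp//.
        apply/negbTE; rewrite notin_setE /= in_itv /=; lra.
      move=> _; rewrite add0e; case: ifPn; rewrite ?inE ?notin_setE /= in_itv /= => dq.
        by rewrite -EFinD lee_fin fq.
      by rewrite adde0 lee_fin fW.
  - by move=> d _; rewrite lee_fin.
  - by move=> d _; rewrite adde_ge0.
  - by apply: emeasurable_funD; exact: mgA.
exact: mgA.
Qed.

(** * The expected ratio for total weight at least x *)

Lemma powR_log (R : realType) (x v : R) : 1 < x -> 0 < v -> x `^ (ln v / ln x) = v.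
Proof.
move=> x1 v0; rewrite /powR gt_eqF ?(lt_trans _ x1)// divfK ?lnK ?posrE//.
by rewrite gt_eqF ?ln_gt0.
Qed.

Lemma ltr_powR_mono (R : realType) (x u v : R) : 1 < x -> (x `^ u < x `^ v) = (u < v).
Proof.
move=> x1; rewrite /powR gt_eqF ?(lt_trans _ x1)// ltr_expR.
by rewrite ltr_pM2r ?ln_gt0.
Qed.

Lemma ler_powR_mono (R : realType) (x u v : R) : 1 < x -> (x `^ u <= x `^ v) = (u <= v).
Proof. by move=> x1; rewrite !leNgt ltr_powR_mono. Qed.

Lemma expectation_alg_ratio_log (R : realType) (x : R) (X : seq nat) :
  2 < x -> x <= (sumn X)%:R ->
  let W := (sumn X)%:R in let O := (opt_bottleneck X)%:R in
  W / x < W - O ->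
  (O%:E * 'E_(uniform_prob (@ltr01 R))[alg_ratio x X] +
     ((W - O - W / x) / ln x)%:E <= W%:E)%E.
Proof.
move=> x2 xW W O WxA.
have x1 : 1 < x by lra.
have x0 : 0 < x by lra.
have W0 : 0 < W by lra.
have A0 : 0 < W - O by apply: le_lt_trans WxA; rewrite divr_ge0 ?ltW.
have O0 : 0 < O.
  have := opt_bottleneck_ge X; rewrite -(ler_nat R) natrM -/W -/O; lra.
have OW : O <= W by rewrite ler_nat opt_bottleneck_le.
(* With W = x^T, W - O = x^S and m = floor T: the trigger point is x^(m+d) for
   d <= T - m and x^(m-1+d) for d > T - m, and it is at most W - O for d in ]0, p]
   and d in ]T - m, q]. *)
pose T := ln W / ln x; pose S := ln (W - O) / ln x.
have xT : x `^ T = W by exact: powR_log.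
have xS : x `^ S = W - O by exact: powR_log.
have T1 : 1 <= T by rewrite -(ler_powR_mono _ _ _ _ x1) xT powRr1// ltW.
have ST : S <= T by rewrite -(ler_powR_mono _ _ _ _ x1) xT xS; lra.
(* This is W / x < W - O on the logarithmic scale; it yields T - m <= q below. *)
have TS : T - 1 < S.
  rewrite -(ltr_powR_mono _ _ _ _ x1) powRB ?(gt_eqF x0) ?implybT//.
  by rewrite xT xS powRr1 ?ltW.
have /andP[mT Tm] := @truncn_itv R T ltac:(lra).
set m : nat := Num.truncn T in mT Tm.
rewrite -natr1 in Tm.
pose p := Num.max 0 (S - m%:R); pose q := Num.min 1 (S - m%:R + 1).
have p0 : 0 <= p by rewrite le_max lexx.
have pt : p <= T - m%:R by rewrite ge_max; apply/andP; split; lra.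
have tq : T - m%:R <= q by rewrite le_min; apply/andP; split; lra.
have q1 : q <= 1 by rewrite ge_min lexx.
have pS : 0 < p -> p = S - m%:R 
  by rewrite /p lt_max ltxx /= => Sm; rewrite max_r// ltW.
have qS : q <= S - m%:R + 1 by rewrite ge_min lexx orbT.
have ratioE d : O * alg_ratio x X d = (bottleneck X (alg_sep x X d))%:R.
  by rewrite /alg_ratio -/O mulrC divfK ?gt_eqF.
(* Since x^d <= x <= W, the separator has been placed at least once. *)
have cut d : 0 <= d <= 1 -> exists k : nat, k%:R + d <= T < k%:R + 1 + d /\
    (k%:R + d <= S -> O * alg_ratio x X d + x `^ (k%:R + d) <= W).
  move=> /andP[d0 d1]; have xd : x `^ d <= (sumn X)%:R.
    by rewrite (le_trans _ xW)// -[leRHS](powRr1 (ltW x0)) ler_powR_mono.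
  have [k [kW kS]] := bottleneck_alg_sep _ _ _ x2 d0 _ xd; exists k; split.
    by move: kW; rewrite -/W -xT ler_powR_mono// ltr_powR_mono// natr1.
  by move=> kdS; rewrite ratioE; apply: kS; rewrite -/W -/O -xS ler_powR_mono.
have := @integral_add_powR_le R (fun d => O * alg_ratio x X d) x W m%:R (m%:R - 1)
  p (T - m%:R) q x1 p0 pt tq q1.
(* If S > m, then q = 1 and the terms x^m cancel; otherwise p = 0 and the first difference vanishes.
   Either way x^S - x^(T-1) remains. *)
have -> : ((x `^ (m%:R + p) - x `^ (m%:R + 0)) / ln x +
   (x `^ (m%:R - 1 + q) - x `^ (m%:R - 1 + (T - m%:R))) / ln x)%R
   = ((W - O - W / x) / ln x)%R.
  have -> : x `^ (m%:R - 1 + (T - m%:R)) = W / x.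
    rewrite (_ : m%:R - 1 + (T - m%:R) = T - 1); last by ring.
    by rewrite powRB ?(gt_eqF x0) ?implybT// xT powRr1 ?ltW.
  rewrite -mulrDl; congr (_ / _); rewrite /p /q.
  case: (leP (S - m%:R) 0) => Sm.
    rewrite min_r; last lra.
    rewrite (_ : m%:R - 1 + (S - m%:R + 1) = S); last by ring.
    by rewrite xS; ring.
  rewrite min_l; last lra.
  rewrite (_ : m%:R + (S - m%:R) = S); last by ring.
  rewrite (_ : m%:R - 1 + 1 = m%:R); last by ring.
  by rewrite xS addr0; ring.
rewrite expectation_alg_ratioE -ge0_integralZl_EFin//=; last 2 first.
- by move=> d _; rewrite lee_fin alg_ratio_ge0.
- by apply/measurable_EFinP/measurable_funTS; exact: measurable_alg_ratio.
apply.
- by apply: measurable_funM => //; exact: measurable_alg_ratio.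
- by move=> d; rewrite mulr_ge0 ?alg_ratio_ge0// ltW.
- by move=> d _; rewrite ratioE ler_nat bottleneck_le.
- move=> d /andP[d0 dp].
  have [|k [/andP[kT Tk] kS]] := cut d; first lra.
  have mk : m = k.
    apply/eqP; rewrite eqn_leq; apply/andP.
    by split; rewrite -ltnS -(ltr_nat R) -natr1; lra.
  by rewrite mk; apply: kS; rewrite -mk; have := pS ltac:(lra); lra.
- move=> d /andP[dT dq].
  have [|k [/andP[kT Tk] kS]] := cut d; first lra.
  have mk : m = k.+1.
    apply/eqP; rewrite eqn_leq; apply/andP.
    by split; rewrite -ltnS -(ltr_nat R) -!natr1; lra.
  rewrite mk -natr1 addrK; apply: kS.
  by move: dq qS; rewrite mk -natr1; lra.
Qed.

Lemma expectation_alg_ratio_large (R : realType) (x : R) (X : seq nat) :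
  2 < x -> x <= (sumn X)%:R ->
  ('E_(uniform_prob (@ltr01 R))[alg_ratio x X] <=
     (2 - (1 - 2 / x) / ln x)%:E)%E.
Proof.
move=> x2 xW; set E := (X in (X <= _)%E).
pose W : R := (sumn X)%:R; pose O : R := (opt_bottleneck X)%:R.
have W0 : 0 < W by rewrite /W; lra.
have x0 : 0 < x by lra.
have OW : O <= W by rewrite ler_nat opt_bottleneck_le.
have WO : W <= 2 * O by rewrite -natrM ler_nat opt_bottleneck_ge.
have O0 : 0 < O by lra.
have lnx0 : 0 < ln x by rewrite ln_gt0//; lra.
(* From ln (1 + u) <= u at u = 1/x - 1. It makes the coefficient of W in the final bound
   nonnegative, so that W may be replaced by 2 O. *)
have lnx : 1 - x^-1 <= ln x.
  have xV : -1 < x^-1 - 1 by rewrite ltrBrDl subrr invr_gt0.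
  by have := le_ln1Dx xV; rewrite addrC subrK lnV ?posrE//; lra.
have ED : (O%:E * E + ((W - O - W / x) / ln x)%:E <= W%:E)%E.
  have [WxA|AWx] := ltP (W / x) (W - O); first exact: expectation_alg_ratio_log.
  (* Here the claimed saving is at most 0, so the trivial bound on the ratio is enough. *)
  have EWO : (E <= (W / O)%:E)%E.
    apply: expectation_alg_ratio_le => d _.
    by rewrite /alg_ratio ler_pM2r ?invr_gt0// ler_nat bottleneck_le.
  have : (O%:E * E <= W%:E)%E.
    rewrite (le_trans (lee_wpmul2l _ EWO)) ?lee_fin ?(ltW O0)//.
    by rewrite mulrC divfK ?gt_eqF.
  move=> OEW; rewrite -[leRHS]adde0; apply: leeD => //.
  by rewrite lee_fin ler_pdivrMr// mul0r; lra.
have : (E <= ((W - (W - O - W / x) / ln x) / O)%:E)%E.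
  rewrite [leRHS]EFinM lee_pdivlMr//.
  by rewrite EFinB leeBrDr// muleC.
move=> /le_trans; apply; rewrite lee_fin ler_pdivrMr//.
set L := ln x in lnx0 lnx *; set y := x^-1 in lnx *.
have -> : W - (W - O - W * y) / L = W * (1 - (1 - y) / L) + O / L.
  by field; rewrite gt_eqF.
have c0 : 0 <= 1 - (1 - y) / L by rewrite subr_ge0 ler_pdivrMr// mul1r.
have -> : (2 - (1 - 2 * y) / L) * O = 2 * O * (1 - (1 - y) / L) + O / L.
  by field; rewrite gt_eqF.
by rewrite lerD2r ler_wpM2r.
Qed.

Theorem theorem6 (R : realType) :
  exists x : R,
    [/\ 2 < x,
        `|x - (5 + 357 / 1000)| <= 1 / 2000 &
        exists C : R, forall X : seq nat,
          (0 < size X)%N ->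
          all (fun w => 0 < w)%N X ->
          ('E_(uniform_prob (@ltr01 R))[alg_ratio x X]
             <= (1627 / 1000 + C / (sumn X)%:R)%:E)%E].
Proof.
have [x [x2 xE lnx]] : exists x : R,
    [/\ 2 < x, x = 5357 / 1000 & ln x <= 168 / 100].
  by exists (5357 / 1000); split; [lra|reflexivity|exact: ln_5357_le].
exists x; split; first exact: x2.
  by rewrite xE ler_norml; apply/andP; split; lra.
(* For W < x the ratio is at most 2, which C / W exceeds when C = 2 x; for W >= x only C / W >= 0
   matters. *)
exists (2 * x) => X sX X0.
have W0 : (0 < sumn X)%N.
  by case: X sX X0 => //= w X _ /andP[w0 _]; rewrite addn_gt0 w0.
have WR : 0 < (sumn X)%:R :> R by rewrite ltr0n.
have CW : 0 <= 2 * x / (sumn X)%:R.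
  by apply: divr_ge0; [lra|exact: ltW].
have [xW|Wx] := leP x (sumn X)%:R.
  apply: le_trans (expectation_alg_ratio_large _ _ _ x2 xW) _.
  have lnx0 : 0 < ln x by apply: ln_gt0; lra.
  (* 373/1000 is 2 - 1.627. The margin is thin: 2 / x is about 0.37334, against the bound 0.37336
     required below. *)
  suff : 373 / 1000 <= (1 - 2 / x) / ln x by rewrite lee_fin; lra.
  rewrite ler_pdivlMr; last exact: lnx0.
  have : 2 / x <= 1 - 373 / 1000 * (168 / 100).
    by rewrite ler_pdivrMr; [rewrite xE; lra|lra].
  by lra.
apply: expectation_alg_ratio_le => d _.
have O0 : 0 < (opt_bottleneck X)%:R :> R.
  by rewrite ltr0n; move: W0 (opt_bottleneck_ge X); clear; lia.
have ratio2 : alg_ratio x X d <= 2.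
  rewrite /alg_ratio ler_pdivrMr; last exact: O0.
  rewrite -natrM ler_nat.
  exact: leq_trans (bottleneck_le _ _) (opt_bottleneck_ge _).
have : 2 <= 2 * x / (sumn X)%:R by rewrite ler_pdivlMr; [lra|exact: WR].
by lra.
Qed.
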